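(* Let $n\ge2$ and let $s=(s_1,\dots,s_n)$ with $0\le s_1<s_2<\dots<s_n$. A permutation $v_1,v_2,\ldots,v_n$ of $s$ provides the minimum loop cost (among all permutations of $s$) if and only if it is loop-equivalent to a sequence that is order-isomorphic to \[2,\ n-2,\ 4,\ \dots,\ n-3,\ 3,\ n-1,\ 1,\ n.\]
   Context: For $\vec v=(v_1,\dots,v_n)$ with $n\ge2$, the loop cost is $C_L(\vec v)=v_1v_2+v_2v_3+\cdots+v_{n-1}v_n+v_nv_1$. Two sequences are loop-equivalent if one can be obtained from the other by rotations (cyclic shifts) and reflections (reversal). A sequence $\vec v$ of distinct reals is order-isomorphic to a permutation $(p_1,\dots,p_n)$ of $\{1,\dots,n\}$ if $p_i<p_j\iff v_i<v_j$ for all $i,j$. The displayed permutation is to be read as follows. Let $\tau=(\tau_1,\dots,\tau_n)=(n,2,n-2,4,\dots,n-3,3,n-1,1)$ be the permutation of $\{1,\dots,n\}$ filled from the left by $n,2,n-2,4,n-4,6,\dots$ and from the right by $1,n-1,3,n-3,5,\dots$; explicitly, for $1\le i\le\lceil n/2\rceil$, $\tau_i=n+1-i$ if $i$ is odd and $\tau_i=i$ if $i$ is even, and for $1\le k\le\lfloor n/2\rfloor$, $\tau_{n+1-k}=k$ if $k$ is odd and $\tau_{n+1-k}=n+1-k$ if $k$ is even. The displayed permutation is the rotation $(\tau_2,\tau_3,\dots,\tau_n,\tau_1)$. For example: $n=4$: $(2,3,1,4)$; $n=5$: $(2,3,4,1,5)$; $n=8$: $(2,6,4,5,3,7,1,8)$.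 *)

(* Defs.v *)
From mathcomp Require Import all_boot all_order all_algebra.
From mathcomp Require Import reals.

Set Implicit Arguments.
Unset Strict Implicit.
Unset Printing Implicit Defensive.

Import Order.TTheory GRing.Theory Num.Theory.

Local Open Scope ring_scope.

(* Sequences are 0-indexed lists, so v_(i+1) is [v`_i]. *)
Definition loop_cost (R : pzRingType) (v : seq R) : R :=
  \sum_(i < size v) v`_i * v`_(i.+1 %% size v).

(* [loop_equiv v w]: w is obtained from v by finitely many rotations and
   reversals. *)
Inductive loop_equiv (T : Type) (v : seq T) : seq T -> Prop :=
| loop_equiv_refl : loop_equiv v v
| loop_equiv_rot (k : nat) (w : seq T) :
    loop_equiv v w -> loop_equiv v (rot k w)
| loop_equiv_rev (w : seq T) :
    loop_equiv v w -> loop_equiv v (rev w).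

(* When p has no repetition, this forces v to have none either. *)
Definition order_isomorphic (R : realDomainType) (v : seq R) (p : seq nat) :=
  size v = size p /\
  forall i j : nat, (i < size p)%N -> (j < size p)%N ->
    ((nth 0%N p i < nth 0%N p j)%N <-> v`_i < v`_j).

(* [tau n i], for 1 <= i <= n, is the i-th entry of
   n, 2, n-2, 4, n-4, ..., n-3, 3, n-1, 1,
   which is filled alternately from both ends; in the second half,
   k = n+1-i is the rank of the entry counted from the right. *)
Definition tau (n i : nat) : nat :=
  if (i <= uphalf n)%N then
    if odd i then (n.+1 - i)%N else i
  else
    let k := (n.+1 - i)%N in
    if odd k then k else (n.+1 - k)%N.

(* 2, n-2, 4, ..., n-3, 3, n-1, 1, n *)
Definition min_loop_perm (n : nat) : seq nat :=
  rot 1 [seq tau n i | i <- iota 1 n].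

(* Main.v *)
(* In an optimal loop u, reversing a segment must not decrease the cost, which
   gives (u_j - u_(i+1)) (u_i - u_(j+1)) >= 0 for every two edges of the loop.
   Put the maximum at position 0, reflect so that u_(-1) <= u_1, and visit the
   positions in the zigzag order 0, -1, 1, -2, 2, ...: the edges then join
   visits k and k+2, apart from one edge at either end, and by induction on k the inequality forces the k-th
   visited entry to be the maximum (k = 0, 3 mod 4) or the minimum (k = 1, 2
   mod 4) of the entries not visited before. This fixes the relative order, so
   all optimal loops are in one class; a minimum exists and the cost is
   constant on the class, hence the converse. *)
Require Import Defs.
From mathcomp Require Import all_boot all_order all_algebra.
From mathcomp Require Import reals.
From mathcomp Require Import zify ring.

Import Order.TTheory GRing.Theory Num.Theory.

Local Open Scope ring_scope.

(** * Loop cost via open paths; invariance under rotation and reversal *)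

Fixpoint path_cost (R : pzRingType) (x : R) (l : seq R) : R :=
  if l is y :: l' then x * y + path_cost R y l' else 0.
Arguments path_cost {R} x l.

Lemma path_costE (R : pzRingType) (x : R) (l : seq R) :
  path_cost x l = \sum_(i < size l) (x :: l)`_i * l`_i.
Proof.
elim: l x => [|y l IHl] x /=; first by rewrite big_ord0.
by rewrite big_ord_recl /= IHl.
Qed.

Lemma path_cost_cat (R : pzRingType) (x : R) (l1 l2 : seq R) :
  path_cost x (l1 ++ l2) = path_cost x l1 + path_cost (last x l1) l2.
Proof. by elim: l1 x => [|y l1 IHl] x /=; rewrite ?add0r // IHl addrA. Qed.

Lemma path_cost_rcons (R : pzRingType) (x y : R) (l : seq R) :
  path_cost x (rcons l y) = path_cost x l + last x l * y.
Proof. by rewrite -cats1 path_cost_cat /= addr0. Qed.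

Lemma path_cost_rev (R : comPzRingType) (x : R) (l : seq R) :
  path_cost (last x l) (rev (belast x l)) = path_cost x l.
Proof.
elim: l x => [|y l IHl] x //=.
rewrite rev_cons path_cost_rcons IHl addrC mulrC; congr (_ * _ + _).
by case: l {IHl} => //= z l; rewrite rev_cons last_rcons.
Qed.

(** A loop is a path that returns to its start; this removes the modular index. *)
Lemma loop_cost_cons (R : pzRingType) (x : R) (l : seq R) :
  loop_cost (x :: l) = path_cost x (rcons l x).
Proof.
rewrite path_costE size_rcons; apply: eq_bigr => -[i /= lti] _.
rewrite -rcons_cons nth_rcons /= lti; congr (_ * _).
rewrite nth_rcons; case: ltngtP => [lt|lt|->]; last by rewrite modnn.
- by rewrite modn_small.
- by move: lt; rewrite ltnNge -ltnS lti.
Qed.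

Lemma loop_cost_catC (R : pzRingType) (l1 l2 : seq R) :
  loop_cost (l1 ++ l2) = loop_cost (l2 ++ l1).
Proof.
case: l1 l2 => [|x l1] [|y l2]; rewrite ?cats0 // !cat_cons !loop_cost_cons.
rewrite !rcons_cat !path_cost_cat /= !path_cost_rcons.
by rewrite [LHS]addrA [LHS]addrC -[LHS]addrA.
Qed.

Lemma loop_cost_rot (R : pzRingType) (k : nat) (v : seq R) :
  loop_cost (rot k v) = loop_cost v.
Proof. by rewrite loop_cost_catC cat_take_drop. Qed.

Lemma loop_cost_rev (R : comPzRingType) (v : seq R) :
  loop_cost (rev v) = loop_cost v.
Proof.
case: v => // x l.
rewrite rev_cons -cats1 loop_cost_catC /= !loop_cost_cons -[RHS]path_cost_rev.
by rewrite last_rcons belast_rcons rev_cons.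
Qed.

Lemma loop_equiv_cost (R : comPzRingType) (v w : seq R) :
  loop_equiv v w -> loop_cost w = loop_cost v.
Proof.
by elim=> // [k u _ <-|u _ <-]; rewrite ?loop_cost_rot ?loop_cost_rev.
Qed.

Lemma loop_equiv_perm (T : eqType) (v w : seq T) :
  loop_equiv v w -> perm_eq w v.
Proof. by elim=> // [k u _|u _]; rewrite ?perm_rot ?perm_rev. Qed.

(** * Optimal loops and the exchange inequality *)

Definition loop_optimal (R : numDomainType) (v : seq R) :=
  forall w : seq R, perm_eq w v -> loop_cost v <= loop_cost w.
Arguments loop_optimal {R} v.

Lemma loop_optimal_equiv (R : numDomainType) (v w : seq R) :
  loop_equiv v w -> loop_optimal v -> loop_optimal w.
Proof.
move=> vw optv u uw; rewrite (loop_equiv_cost _ _ _ vw); apply: optv.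
exact: perm_trans uw (loop_equiv_perm _ _ _ vw).
Qed.

Lemma seq_min (T : eqType) (R : realDomainType) (f : T -> R) (x : T) (l : seq T) :
  exists2 y, y \in x :: l & {in x :: l, forall z, f y <= f z}.
Proof.
elim: l x => [|y l IHl] x.
  by exists x; rewrite ?mem_head // => z /[!inE] /eqP ->.
have [z zl minz] := IHl y; have [xz|zx] := leP (f x) (f z).
  exists x; rewrite ?mem_head // => t /[1!inE] /predU1P[-> //|/minz].
  exact: le_trans.
exists z; first by rewrite inE zl orbT.
by move=> t /[1!inE] /predU1P[->|/minz //]; apply: ltW.
Qed.

Lemma loop_optimal_exists (R : realDomainType) (s : seq R) :
  exists2 v, perm_eq v s & loop_optimal v.
Proof.
have : s \in permutations s by rewrite mem_permutations.
case E: (permutations s) => [|w l] // _.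
have [v] := seq_min _ _ (@loop_cost R) w l.
rewrite -E mem_permutations => vs minv; exists v => // u uv.
by apply: minv; rewrite mem_permutations (perm_trans uv).
Qed.

(* Compare with the loop in which the segment [y :: l2] is reversed. *)
Lemma loop_optimal_cat (R : realDomainType) (x y : R) (l1 l2 : seq R) :
  loop_optimal (x :: l1 ++ y :: l2) ->
  0 <= (last x l1 - x) * (last y l2 - y).
Proof.
move=> /(_ (x :: l1 ++ rev (y :: l2))).
rewrite perm_cons perm_cat2l perm_rev => /(_ (perm_refl _)).
rewrite !loop_cost_cons lastI rev_rcons !rcons_cat !path_cost_cat /=.
rewrite -lastI /= !path_cost_rcons path_cost_rev.
have -> : last (last y l2) (rev (belast y l2)) = y.
  by case: l2 => //= z l2; rewrite rev_cons last_rcons.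
by rewrite -subr_ge0; congr (0 <= _); ring.
Qed.

Lemma nth_rot_mod (T : Type) (x0 : T) (k i : nat) (s : seq T) :
  (k <= size s)%N -> (i < size s)%N ->
  nth x0 (rot k s) i = nth x0 s ((k + i) %% size s).
Proof.
move=> lek lti; rewrite /rot nth_cat size_drop.
case: ltnP => [lt|le].
  by rewrite nth_drop modn_small //; lia.
have -> : (k + i = size s + (i - (size s - k)))%N by lia.
rewrite modnDl modn_small; last by lia.
by rewrite nth_take //; lia.
Qed.

Lemma loop_optimal_nth (R : realDomainType) (u : seq R) (i j : nat) :
  (i < size u)%N -> (j < size u)%N -> loop_optimal u ->
  0 <= (u`_j - u`_(i.+1 %% size u)) * (u`_i - u`_(j.+1 %% size u)).
Proof.
wlog ltij : i j / (i < j)%N => [hw lti ltj optu|].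
  have [lt|lt|->] := ltngtP i j; first exact: hw.
    rewrite -mulrNN !opprB mulrC.
    have := hw _ _ lt ltj lti optu.
    by congr (0 <= _); ring.
  exact: sqr_ge0.
move=> lti ltj optu.
(* Start the loop just after position [i]: its first [p] entries then run from position [i.+1] to
   [j], the others from [j.+1] round to [i]. *)
have /loop_optimal_equiv/(_ optu) : loop_equiv u (rot i.+1 u).
  by apply: loop_equiv_rot; apply: loop_equiv_refl.
set r := rot i.+1 u; set p := (j - i)%N => optr.
have sr : size r = size u by rewrite size_rot.
have [p0 pr] : (0 < p /\ p < size r)%N by rewrite sr /p; lia.
have nr k : (k < size u)%N -> r`_k = u`_((i.+1 + k) %% size u).
  by move=> ?; rewrite /r nth_rot_mod.
have : r = take p r ++ drop p r by rewrite cat_take_drop.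
case E1: (take p r) => [|x l1].
  by move/(congr1 size): E1; rewrite size_take pr /=; lia.
case E2: (drop p r) => [|y l2].
  by move/(congr1 size): E2; rewrite size_drop /=; lia.
move=> E; rewrite E /= in optr; have := loop_optimal_cat _ _ _ _ _ optr.
have s1 : size (x :: l1) = p by rewrite -E1 size_takel // ltnW.
have s2 : size (y :: l2) = (size u - p)%N by rewrite -E2 size_drop sr.
have -> : last x l1 = u`_j.
  rewrite (last_nth 0) -[size l1]/((size (x :: l1)).-1) s1 -E1.
  rewrite nth_take; last by lia.
  by rewrite nr ?modn_small //; try congr (u`_ _); rewrite /p; lia.
have -> : x = u`_(i.+1 %% size u).
  by rewrite -[x]/((x :: l1)`_0) -E1 nth_take // nr ?addn0 //; lia.
have -> : last y l2 = u`_i.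
  rewrite (last_nth 0) -[size l2]/((size (y :: l2)).-1) s2 -E2 nth_drop.
  rewrite nr; last by lia.
  have -> : (i.+1 + (p + (size u - p).-1) = size u + i)%N by lia.
  by rewrite modnDl modn_small.
have -> // : y = u`_(j.+1 %% size u).
rewrite -[y]/((y :: l2)`_0) -E2 nth_drop addn0 nr -?sr //.
by congr (u`_(_ %% _)); rewrite /p; lia.
Qed.

(** * The zigzag order of visits *)

(* [zigzag n i] is the rank of position i in 0, n-1, 1, n-2, 2, ... *)
Definition zigzag (n i : nat) : nat :=
  if (i.*2 < n)%N then i.*2 else (n - i).*2.-1.

Definition zigzag_top (k : nat) : bool := ((k %% 4 == 0) || (k %% 4 == 3))%N.

Lemma zigzag_topSS (k : nat) : zigzag_top k.+2 = ~~ zigzag_top k.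
Proof. by rewrite /zigzag_top; lia. Qed.

(** Each entry is extremal among itself and those visited later. The relation is a parameter so that
    both [tau] and a loop of ring elements qualify. *)
Definition zigzag_ordered (n : nat) (lt : rel nat) :=
  forall i j : nat, (i < n)%N -> (j < n)%N -> (zigzag n i < zigzag n j)%N ->
    if zigzag_top (zigzag n i) then lt j i else lt i j.

Lemma zigzag_inj (n i j : nat) :
  (i < n)%N -> (j < n)%N -> zigzag n i = zigzag n j -> i = j.
Proof. by rewrite /zigzag; case: (ltnP i.*2 n); case: (ltnP j.*2 n); lia. Qed.

(** Read in visiting order, [tau] is n, 1, 2, n-1, n-2, 3, 4, ... *)
Lemma tau_zigzag_ordered (n : nat) :
  zigzag_ordered n (fun i j => tau n i.+1 < tau n j.+1)%N.
Proof.
move=> i j lti ltj; rewrite /zigzag_top /zigzag /tau.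
by case: (ltnP i.*2 n); case: (ltnP j.*2 n);
  case: ifP; case: ifP; case: ifP; case: ifP; case: ifP; lia.
Qed.

Lemma succ_modE (n i : nat) :
  (i < n)%N -> (i.+1 %% n)%N = if (i.+1 == n)%N then 0%N else i.+1.
Proof. by move=> lti; case: eqP => [->|ne]; rewrite ?modnn // modn_small; lia. Qed.

Lemma loop_optimal_zigzag (R : realDomainType) (u : seq R) :
  uniq u -> (forall i, (i < size u)%N -> u`_i <= u`_0) ->
  u`_(size u).-1 <= u`_1 -> loop_optimal u ->
  zigzag_ordered (size u) (fun i j => u`_i < u`_j).
Proof.
move=> uu max0 le1 optu; set n := size u.
have neu i j : (i < n)%N -> (j < n)%N -> i <> j -> u`_i != u`_j.
  by move=> ? ? /eqP; rewrite (nth_uniq 0).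
move=> i; have [k] := ubnP (zigzag n i).
elim: k i => // k IHk i ltk j lti ltj ltij.
have ne : u`_i != u`_j by apply: neu => // eij; rewrite eij ltnn in ltij.
have z0 : zigzag n 0 = 0%N by rewrite /zigzag double0; case: ifP; lia.
have [i0|i_gt0] := posnP i.
  by rewrite i0 in ne *; rewrite z0 lt_neqAle eq_sym ne max0.
have [ltn|len] := ltnP i.*2 n.
  (* Front half: pair the edge from [i.-1] to [i] with the edge from [j] to [c]. A position visited
     after [i] has its successor visited after [i.-1], so induction gives the strict sign of
     [u_(i-1) - u_c], and the exchange inequality transfers it to [u_j - u_i]. *)
  set c := (j.+1 %% n)%N.
  have [ltc zc] : (c < n)%N /\ (zigzag n i.-1 < zigzag n c)%N.
    rewrite /c succ_modE //; move: ltij; rewrite /zigzag ltn.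
    have -> : (i.-1.*2 < n)%N by lia.
    case: eqP => ej; first by case: (ltnP j.*2 n); lia.
    by case: (ltnP j.*2 n); case: (ltnP j.+1.*2 n); lia.
  have zi : zigzag n i = (zigzag n i.-1).+2.
    by rewrite /zigzag ltn; case: ltnP; lia.
  have ltk' : (zigzag n i.-1 < k)%N by rewrite zi in ltk; lia.
  have lti' : (i.-1 < n)%N by lia.
  have := IHk i.-1 ltk' c lti' ltc zc.
  have := loop_optimal_nth _ _ i.-1 j lti' ltj optu.
  rewrite prednK // -/n modn_small // -/c zi zigzag_topSS.
  case: zigzag_top => /= /[swap]; rewrite -subr_gt0 => sg.
    by rewrite pmulr_lge0 // subr_ge0 lt_neqAle ne.
  by rewrite -mulrNN !opprB pmulr_lge0 // subr_ge0 lt_neqAle eq_sym ne.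
have zi : zigzag n i = (n - i).*2.-1 by rewrite /zigzag ltnNge len.
have j_gt0 : (0 < j)%N.
  by case: posnP ltij => // ->; rewrite z0.
(* Here [i.+1] modulo [n] and [j.-1] are both position 0, so the exchange inequality is vacuous; the
   chosen orientation of the loop decides. *)
have [/andP[/eqP i1 /eqP j1]|nij] := boolP ((i == n.-1) && (j == 1%N)).
  rewrite zi (_ : (n - i)%N = 1%N); last by lia.
  by rewrite /= lt_neqAle ne i1 j1.
(* Back half, mirrored: pair the edge from [i] to [b] with the edge from [j.-1] to [j]. Here [b] is
   visited two steps before [i], or one step before if [b] is 0. *)
set b := (i.+1 %% n)%N.
have [ltb zb] : (b < n)%N /\ (zigzag n b < zigzag n j.-1)%N.
  rewrite /b succ_modE //; case: eqP => ei.
    by rewrite z0 /zigzag; split; [|case: (ltnP j.-1.*2 n)]; lia.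
  move: ltij; rewrite zi /zigzag.
  have -> : (i.+1.*2 < n)%N = false by lia.
  by case: (ltnP j.*2 n); case: (ltnP j.-1.*2 n); lia.
have zib : zigzag_top (zigzag n i) = (b != 0%N) && ~~ zigzag_top (zigzag n b).
  rewrite zi /b succ_modE //; case: (eqVneq i.+1 n) => ei /=.
    by rewrite (_ : (n - i)%N = 1%N) //; lia.
  rewrite /zigzag (_ : (i.+1.*2 < n)%N = false); last by lia.
  by rewrite -zigzag_topSS; congr zigzag_top; lia.
have ltbi : (zigzag n b < k)%N.
  rewrite /b succ_modE // in zb *; case: eqP zb => ei zb.
    by rewrite z0; rewrite zi in ltk; lia.
  by rewrite zi in ltk; rewrite /zigzag (_ : (i.+1.*2 < n)%N = false); lia.
have ltj' : (j.-1 < n)%N by lia.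
have := IHk b ltbi j.-1 ltb ltj' zb.
have := loop_optimal_nth _ _ i j.-1 lti ltj' optu.
rewrite prednK // -/n (modn_small ltj) -/b zib.
case: (eqVneq b 0%N) => [->|_]; first rewrite z0 /=.
  move=> /[swap]; rewrite -subr_gt0 => sg.
  by rewrite -mulrNN !opprB pmulr_rge0 // subr_ge0 lt_neqAle ne.
case: zigzag_top => /= /[swap]; rewrite -subr_gt0 => sg.
  by rewrite -mulrNN !opprB pmulr_rge0 // subr_ge0 lt_neqAle ne.
by rewrite pmulr_rge0 // subr_ge0 lt_neqAle eq_sym ne.
Qed.

(** * Order types and the characterization *)

Lemma order_isomorphic_rot (R : realDomainType) (k : nat) (v : seq R)
    (p : seq nat) :
  (k <= size v)%N -> order_isomorphic v p ->
  order_isomorphic (rot k v) (rot k p).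
Proof.
move=> lek [sz iso]; split; first by rewrite !size_rot.
move=> i j; rewrite !size_rot => lti ltj.
have n0 : (0 < size p)%N by lia.
rewrite !nth_rot_mod ?sz // -?sz //.
by rewrite sz; apply: iso; rewrite ltn_mod.
Qed.

(** An entry is determined by the number of entries below it, and [p] fixes that number at every
    position. *)
Lemma order_isomorphic_perm_eq (R : realDomainType) (v w : seq R) (p : seq nat) :
  order_isomorphic v p -> order_isomorphic w p -> perm_eq v w -> v = w.
Proof.
move=> [szv isov] [szw isow] vw.
have szvw : size v = size w by rewrite szv szw.
pose rk x := count (fun y => y < x) w.
have rk_lt x y : x \in w -> x < y -> (rk x < rk y)%N.
  move=> xw ltxy; rewrite /rk -!sum1_count.
  rewrite [ltnRHS]big_mkcond [ltnLHS]big_mkcond /=.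
  (* The entry [x] itself counts for [y] but not for [x], which makes the inequality strict. *)
  rewrite (big_rem x xw) [ltnRHS](big_rem x xw) /= ltxx ltxy add0n.
  rewrite add1n ltnS; apply: leq_sum => z _.
  by case: ifP => // /lt_trans/(_ ltxy) ->.
apply: (@eq_from_nth _ 0) => // i lti.
have rkE : rk v`_i = rk w`_i.
  (* Count the left side in [v] instead of [w], then count positions: at each one both comparisons
     agree with that of [p]. *)
  rewrite /rk -(permP vw).
  rewrite -[X in count _ X = _](mkseq_nth 0) -[X in _ = count _ X](mkseq_nth 0).
  rewrite /mkseq !count_map -szvw.
  apply: eq_in_count => j; rewrite mem_iota /= => ltj.
  have ltjp : (j < size p)%N by rewrite -szv.
  have ltip : (i < size p)%N by rewrite -szv.
  by apply/idP/idP => [/isov-/(_ ltjp ltip)/isow->|/isow-/(_ ltjp ltip)/isov->].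
have vi : v`_i \in w by rewrite -(perm_mem vw) mem_nth.
have wi : w`_i \in w by rewrite mem_nth // -szvw.
by have [/(rk_lt _ _ vi)|/(rk_lt _ _ wi)|//] := ltgtP v`_i w`_i; rewrite rkE ltnn.
Qed.

(** For two positions, the earlier visited one settles the comparison, in the same way for [u] and
    for [tau]. *)
Lemma zigzag_order_isomorphic (R : realDomainType) (u : seq R) :
  zigzag_ordered (size u) (fun i j => u`_i < u`_j) ->
  order_isomorphic u [seq tau (size u) i | i <- iota 1 (size u)].
Proof.
set n := size u => zu; split; first by rewrite size_map size_iota.
rewrite size_map size_iota => i j lti ltj.
rewrite !(nth_map 0%N) ?size_iota // !nth_iota // !add1n.
have zt := tau_zigzag_ordered n.
have [lt|lt|/zigzag_inj->//] := ltngtP (zigzag n i) (zigzag n j).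
- have := zu i j lti ltj lt; have := zt i j lti ltj lt; case: ifP => _ /= lt1 lt2.
    by rewrite (ltNge _ u`_j) (ltW lt2) ltnNge (ltnW lt1).
  by rewrite lt1 lt2.
- have := zu j i ltj lti lt; have := zt j i ltj lti lt; case: ifP => _ /= lt1 lt2.
    by rewrite lt1 lt2.
  by rewrite (ltNge _ u`_j) (ltW lt2) ltnNge (ltnW lt1).
- by rewrite ltnn ltxx.
Qed.

Lemma loop_optimal_order_isomorphic (R : realDomainType) (v : seq R) :
  (2 <= size v)%N -> uniq v -> loop_optimal v ->
  exists2 w, loop_equiv v w & order_isomorphic w (min_loop_perm (size v)).
Proof.
move=> v2 uv optv.
suff [u vu [max0 le1]] : exists2 u, loop_equiv v u &
    (forall x, x \in u -> x <= u`_0) /\ u`_(size u).-1 <= u`_1.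
  have uvp := loop_equiv_perm _ _ _ vu; have szu := perm_size uvp.
  (* The maximum leads in [tau] but comes last in [min_loop_perm]. *)
  exists (rot 1 u); first exact: loop_equiv_rot.
  rewrite /min_loop_perm -szu.
  apply: order_isomorphic_rot; first by rewrite szu ltnW.
  apply: zigzag_order_isomorphic; apply: loop_optimal_zigzag => //.
  - by rewrite (perm_uniq uvp).
  - by move=> i lti; apply/max0/mem_nth.
  - exact: loop_optimal_equiv vu optv.
(* Minimizing the opposite yields the maximum. *)
have [x xv maxx] : exists2 x, x \in v & {in v, forall y, - x <= - y}.
  by case: v v2 {uv optv} => // x l _; apply: seq_min.
have [k l vE] := rot_to xv.
have vu : loop_equiv v (x :: l) by rewrite -vE; apply/loop_equiv_rot/loop_equiv_refl.
have uvp := loop_equiv_perm _ _ _ vu; have szu := perm_size uvp.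
have maxl y : y \in x :: l -> y <= x.
  by rewrite (perm_mem uvp) => /maxx; rewrite lerN2.
case: l => [|y l] in vu uvp szu maxl {vE} *.
  by rewrite -szu in v2.
have [le|/ltW le] := leP (last y l) y.
  exists [:: x, y & l] => //; split => //=.
  by rewrite -[size l]/((size (y :: l)).-1) nth_last.
(* Reverse the loop while keeping the maximum in front, which swaps its two neighbours. *)
exists (x :: rev (y :: l)).
  have -> : x :: rev (y :: l) = rotr 1 (rev [:: x, y & l]).
    by rewrite (rev_cons x) rotr1_rcons.
  exact/loop_equiv_rot/loop_equiv_rev.
split=> [z|]; first by rewrite inE mem_rev; apply: maxl.
have -> : (x :: rev (y :: l))`_1 = last y l.
  by rewrite /= nth_rev // subn1 nth_last.
by rewrite nth_last /= rev_cons last_rcons.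
Qed.

Theorem theorem21 (R : realType) (n : nat) (s : n.-tuple R) (v : seq R)
    (hn : (2 <= n)%N) (hs0 : 0 <= s`_0) (hs : sorted <%R s)
    (hv : perm_eq v s) :
  (forall w : seq R, perm_eq w s -> loop_cost v <= loop_cost w) <->
  (exists w : seq R, loop_equiv v w /\ order_isomorphic w (min_loop_perm n)).
Proof.
have class u : perm_eq u s -> loop_optimal u ->
    exists2 w, loop_equiv u w & order_isomorphic w (min_loop_perm n).
  move=> us optu; have szu : size u = n by rewrite (perm_size us) size_tuple.
  rewrite -szu; apply: loop_optimal_order_isomorphic; rewrite ?szu //.
  by rewrite (perm_uniq us) (sorted_uniq lt_trans ltxx).
split=> [minv|[w [vw wiso]] u us].
  have [|w vw wiso] := class v hv; last by exists w.
  by move=> u /perm_trans/(_ hv); apply: minv.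
(* Compare with some optimal [m]: its representative has the order type and the entries of [w],
   hence equals [w], and the costs agree. *)
have [m ms optm] := loop_optimal_exists _ s.
have [m' mm' m'iso] := class m ms optm.
have wm' : w = m'.
  apply: order_isomorphic_perm_eq wiso m'iso _.
  rewrite (perm_trans (loop_equiv_perm _ _ _ vw)) // (perm_trans hv) //.
  by rewrite perm_sym (perm_trans (loop_equiv_perm _ _ _ mm')).
rewrite -(loop_equiv_cost _ _ _ vw) wm' (loop_equiv_cost _ _ _ mm').
by apply: optm; rewrite (perm_trans us) // perm_sym.
Qed.
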